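(* Let $n\ge1$, let $\theta$ be a complex skew-symmetric $n\times n$ matrix, and let $1\le d\le n$. The noncommutative minors of order $d$ in $\mathrm{GL}_\theta(n)$ obey the Plücker relations $$\sum_{\gamma=1}^{d+1}(-1)^{\gamma+1}\Big(\prod_{\alpha=1}^{d}q_{i_\gamma i^\gamma_\alpha}\Big)\Big(\prod_{\beta=1}^{d-1}q_{i_\gamma j_\beta}\Big)\,\Lambda^{I^\gamma}\,\Lambda^{i_\gamma\cup J}=0$$ for every choice of multi-indices $I=(i_1\cdots i_{d+1})$ and $J=(j_1\cdots j_{d-1})$ with entries in $\{1,\dots,n\}$, $|I|=d+1$ and $|J|=d-1$.
   Context: Put $q_{ij}=\exp(\tfrac{\mathrm i}{2}\theta^{ij})$ and $Q_{ij;kl}=q_{ki}\,q_{jl}$. $\mathcal F_n^\theta$, the algebra of $\mathrm{GL}_\theta(n)$, is generated by $g_{ij}$, $1\le i,j\le n$, with relations $g_{ij}\,g_{kl}=Q^2_{ij;kl}\;g_{kl}\,g_{ij}$. For multi-indices $K=(k_1\cdots k_d)$ (rows) and $J=(j_1\cdots j_d)$ (columns), not necessarily ordered, the noncommutative minor is $$\Lambda^{KJ}=\sum_{\sigma\in S_d}\mathrm{sgn}(\sigma)\Big(\prod_{1\le a<b\le d}Q_{k_b\,j_{\sigma(b)}\,;\,k_a\,j_{\sigma(a)}}\Big)\,g_{k_1j_{\sigma(1)}}\cdots g_{k_dj_{\sigma(d)}},$$ with products in $\mathcal F_n^\theta$. When the row multi-index is $(1\,2\cdots d)$ it is omitted: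 $\Lambda^{J}=\Lambda^{(1\cdots d)J}$. $I^\gamma=I\setminus\{i_\gamma\}=(i^\gamma_1\cdots i^\gamma_d)$ is $I$ with its $\gamma$-th entry removed, the remaining entries keeping their order, and $i_\gamma\cup J=(i_\gamma\,j_1\cdots j_{d-1})$ is the concatenation. *)

(* Defs.v *)
From HB Require Import structures.
From mathcomp Require Import all_boot all_order all_algebra all_fingroup.
From mathcomp Require Import generic_quotient ring_quotient.
From mathcomp Require Import boolp reals sequences exp trigo.
From mathcomp Require Import complex.
From mathcomp Require Import monalg.

Set Implicit Arguments.
Unset Strict Implicit.
Unset Printing Implicit Defensive.

Import GRing.Theory.

Local Open Scope ring_scope.
Local Open Scope quotient_scope.
Local Open Scope complex_scope.

Definition cexp (R : realType) (z : R[i]) : R[i] :=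
  (expR (complex.Re z) * cos (complex.Im z)) +i*
  (expR (complex.Re z) * sin (complex.Im z)).

Definition q_theta (R : realType) (n : nat) (theta : 'M[R[i]]_n)
    (i j : 'I_n) : R[i] :=
  cexp ('i / 2%:R * theta i j).

(* Q_{ij;kl} *)
Definition Q_theta (R : realType) (n : nat) (theta : 'M[R[i]]_n)
    (i j k l : 'I_n) : R[i] :=
  q_theta theta k i * q_theta theta j l.

(* {fmonom X} is the free monoid on X, so this is the algebra of
   noncommutative polynomials K<X>. *)
Definition free_alg (K : comNzRingType) (X : choiceType) : Type :=
  {malg K[{fmonom X}]}.

HB.lock Definition free_var (K : comNzRingType) (X : choiceType) (x : X) :
    free_alg K X :=
  mkmalgU (fmu x) 1.

Section FreeAlg.
Variables (K : comNzRingType) (X : choiceType).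

HB.instance Definition _ :=
  GRing.Lalgebra.copy (free_alg K X) {malg K[{fmonom X}]}.

Lemma free_alg_scaleAr (c : K) (x y : free_alg K X) :
  c *: (x * y) = x * (c *: y).
Proof.
have malgC_comm (g : {malg K[{fmonom X}]}) : c%:MP * g = g * c%:MP.
  rewrite !malgM_def fgmulUg fgmulgU; apply: eq_bigr => k _.
  by rewrite mul1m mulm1 mulrC.
rewrite -!mul_malgC.
by rewrite (mulrA c%:MP) (mulrA x) malgC_comm.
Qed.

HB.instance Definition _ :=
  GRing.Lalgebra_isAlgebra.Build K (free_alg K X) free_alg_scaleAr.

(* The constant term, i.e. the augmentation sending all variables to 0. *)
Definition free_aug : free_alg K X -> K := @mcoeff {fmonom X} K (@mone _).

HB.instance Definition _ := GRing.RMorphism.copy free_aug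
  (@mcoeff {fmonom X} K (@mone _)).

Lemma free_augB : {morph free_aug : x y / x - y}.
Proof. exact: rmorphB. Qed.

Lemma free_augD : {morph free_aug : x y / x + y}.
Proof. exact: rmorphD. Qed.

Lemma free_augM : {morph free_aug : x y / x * y}.
Proof. exact: rmorphM. Qed.

Lemma free_augZ (c : K) x : free_aug (c *: x) = c * free_aug x.
Proof. exact: mcoeffZ. Qed.

Lemma free_aug_var (x : X) : free_aug (free_var K x) = 0.
Proof. by rewrite free_var.unlock /free_aug mcoeffU1 fm1_eq1. Qed.

End FreeAlg.

(* The two-sided ideal generated by S, as the set of finite sums of elements
   a * s * b with s in S. *)
Inductive ideal_span (A : pzRingType) (S : A -> Prop) : A -> Prop :=
| ideal_span0 : ideal_span S 0
| ideal_spanD a s b x :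
    S s -> ideal_span S x -> ideal_span S (a * s * b + x).

(* The algebra generated by X with relations x * y = c x y *: (y * x). *)
Section SkewAlg.
Variables (K : comNzRingType) (X : choiceType) (c : X -> X -> K).

Local Notation A := (free_alg K X).

Definition sk_relator (r : A) : Prop :=
  exists x y : X,
    r = free_var K x * free_var K y - c x y *: (free_var K y * free_var K x).

Definition sk_ideal : {pred A} := fun r => `[< ideal_span sk_relator r >].

Lemma sk_idealP (x : A) : reflect (ideal_span sk_relator x) (x \in sk_ideal).
Proof. exact: asboolP. Qed.

Lemma sk_idealD (x y : A) :
  x \in sk_ideal -> y \in sk_ideal -> x + y \in sk_ideal.
Proof.
move=> /sk_idealP hx /sk_idealP hy; apply/sk_idealP.
elim: hx => [|p s q z hs _ ih]; first by rewrite add0r.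
by rewrite -addrA; exact: ideal_spanD.
Qed.

Lemma sk_idealMl (a x : A) : x \in sk_ideal -> a * x \in sk_ideal.
Proof.
move=> /sk_idealP hx; apply/sk_idealP.
elim: hx => [|p s q z hs _ ih]; first by rewrite mulr0; exact: ideal_span0.
by rewrite mulrDr !mulrA; exact: ideal_spanD.
Qed.

Lemma sk_idealMr (a x : A) : x \in sk_ideal -> x * a \in sk_ideal.
Proof.
move=> /sk_idealP hx; apply/sk_idealP.
elim: hx => [|p s q z hs _ ih]; first by rewrite mul0r; exact: ideal_span0.
by rewrite mulrDl -(mulrA (p * s)); exact: ideal_spanD.
Qed.

Lemma sk_ideal_zmod_closed : zmod_closed sk_ideal.
Proof.
split=> [|x y hx hy]; first by apply/sk_idealP; exact: ideal_span0.
by apply: sk_idealD => //; rewrite -mulN1r; exact: sk_idealMl.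
Qed.

HB.instance Definition _ :=
  GRing.isZmodClosed.Build A sk_ideal sk_ideal_zmod_closed.

Lemma sk_ideal_proper : (1 : A) \notin sk_ideal.
Proof.
have aug0 (r : A) : r \in sk_ideal -> free_aug r = 0.
  move=> /sk_idealP; elim=> [|a s b z [x [y ->]] _ ih]; first exact: rmorph0.
  rewrite free_augD ih !free_augM free_augB free_augZ !free_augM !free_aug_var.
  by rewrite !(mulr0, mul0r, subr0, addr0).
by apply/negP => /aug0 /eqP; rewrite rmorph1 oner_eq0.
Qed.

Definition sk_alg : Type := Quotient.quot sk_ideal.

HB.instance Definition _ := EqQuotient.on sk_alg.
HB.instance Definition _ := GRing.Zmodule.on sk_alg.

Definition sk_one : sk_alg := lift_cst sk_alg 1.
Definition sk_mul : sk_alg -> sk_alg -> sk_alg := lift_op2 sk_alg *%R.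
Definition sk_scale (a : K) : sk_alg -> sk_alg := lift_op1 sk_alg ( *:%R a).

Lemma sk_piP (x y : A) :
  reflect (\pi_sk_alg x = \pi_sk_alg y) (x - y \in sk_ideal).
Proof. by rewrite (Quotient.idealrBE sk_ideal); exact: eqP. Qed.

Lemma sk_piD : {morph \pi_sk_alg : x y / x + y}.
Proof. exact: raddfD. Qed.

Lemma sk_pi1 : \pi_sk_alg 1 = sk_one.
Proof. by unlock sk_one. Qed.

Lemma sk_piM (x y : A) : \pi_sk_alg (x * y) = sk_mul (\pi x) (\pi y).
Proof.
unlock sk_mul; apply/sk_piP; set x' := repr _; set y' := repr _.
have hx : x - x' \in sk_ideal by apply/sk_piP; rewrite reprK.
have hy : y - y' \in sk_ideal by apply/sk_piP; rewrite reprK.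
rewrite -(subrK (x' * y) (x * y)) -mulrBl -addrA -mulrBr.
by apply: sk_idealD; [exact: sk_idealMr | exact: sk_idealMl].
Qed.

Lemma sk_piZ a (x : A) : \pi_sk_alg (a *: x) = sk_scale a (\pi x).
Proof.
unlock sk_scale; apply/sk_piP; set x' := repr _.
have hx : x - x' \in sk_ideal by apply/sk_piP; rewrite reprK.
by rewrite -scalerBr -mulr_algl; exact: sk_idealMl.
Qed.

Fact sk_mulA : associative sk_mul.
Proof.
move=> x y z; elim/quotW: x => x; elim/quotW: y => y; elim/quotW: z => z.
by rewrite -!sk_piM mulrA.
Qed.

Fact sk_mul1 : left_id sk_one sk_mul.
Proof. by move=> x; elim/quotW: x => x; rewrite -sk_pi1 -sk_piM mul1r. Qed.

Fact sk_mulr1 : right_id sk_one sk_mul.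
Proof. by move=> x; elim/quotW: x => x; rewrite -sk_pi1 -sk_piM mulr1. Qed.

Fact sk_mulDl : left_distributive sk_mul +%R.
Proof.
move=> x y z; elim/quotW: x => x; elim/quotW: y => y; elim/quotW: z => z.
by rewrite -sk_piD -!sk_piM mulrDl sk_piD.
Qed.

Fact sk_mulDr : right_distributive sk_mul +%R.
Proof.
move=> x y z; elim/quotW: x => x; elim/quotW: y => y; elim/quotW: z => z.
by rewrite -sk_piD -!sk_piM mulrDr sk_piD.
Qed.

Fact sk_one_neq0 : sk_one != 0.
Proof.
apply/eqP; rewrite -(raddf0 \pi_sk_alg) -sk_pi1 => /sk_piP.
by rewrite subr0; apply/negP; exact: sk_ideal_proper.
Qed.

HB.instance Definition _ := GRing.Zmodule_isNzRing.Build sk_alg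
  sk_mulA sk_mul1 sk_mulr1 sk_mulDl sk_mulDr sk_one_neq0.

Fact sk_scaleA a b x : sk_scale a (sk_scale b x) = sk_scale (a * b) x.
Proof. by elim/quotW: x => x; rewrite -!sk_piZ scalerA. Qed.

Fact sk_scale1 : left_id 1 sk_scale.
Proof. by move=> x; elim/quotW: x => x; rewrite -sk_piZ scale1r. Qed.

Fact sk_scaleDr : right_distributive sk_scale +%R.
Proof.
move=> a x y; elim/quotW: x => x; elim/quotW: y => y.
by rewrite -sk_piD -!sk_piZ scalerDr sk_piD.
Qed.

Fact sk_scaleDl x : {morph sk_scale^~ x : a b / a + b}.
Proof. by move=> a b; elim/quotW: x => x; rewrite -!sk_piZ scalerDl sk_piD. Qed.

HB.instance Definition _ := GRing.Zmodule_isLmodule.Build K sk_alg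
  sk_scaleA sk_scale1 sk_scaleDr sk_scaleDl.

Fact sk_scaleAl a (x y : sk_alg) : a *: (x * y) = (a *: x) * y.
Proof.
elim/quotW: x => x; elim/quotW: y => y.
by rewrite -[RHS]/(sk_mul (sk_scale _ _) _) -sk_piZ -sk_piM -scalerAl
  sk_piZ sk_piM.
Qed.

Fact sk_scaleAr a (x y : sk_alg) : a *: (x * y) = x * (a *: y).
Proof.
elim/quotW: x => x; elim/quotW: y => y.
by rewrite -[RHS]/(sk_mul _ (sk_scale _ _)) -sk_piZ -sk_piM -scalerAr
  sk_piZ sk_piM.
Qed.

HB.instance Definition _ :=
  GRing.Lmodule_isLalgebra.Build K sk_alg sk_scaleAl.
HB.instance Definition _ :=
  GRing.Lalgebra_isAlgebra.Build K sk_alg sk_scaleAr.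

Definition sk_gen (x : X) : sk_alg := \pi_sk_alg (free_var K x).

Lemma sk_gen_rel (x y : X) : sk_gen x * sk_gen y = c x y *: (sk_gen y * sk_gen x).
Proof.
rewrite -[LHS]sk_piM -[_ * sk_gen x]sk_piM -[RHS]sk_piZ.
apply/sk_piP/sk_idealP; rewrite -[X in ideal_span _ X]addr0.
rewrite -[X in ideal_span _ (X + 0)]mulr1.
rewrite -[X in ideal_span _ (X * 1 + 0)]mul1r.
by apply: ideal_spanD; [exists x, y | exact: ideal_span0].
Qed.

End SkewAlg.

Section GLTheta.
Variables (R : realType) (n : nat) (theta : 'M[R[i]]_n).

(* g_{ij} g_{kl} = Q_{ij;kl}^2 g_{kl} g_{ij} *)
Definition gl_coef (x y : 'I_n * 'I_n) : R[i] :=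
  (Q_theta theta x.1 x.2 y.1 y.2) ^+ 2.

Definition gl_alg : Type := sk_alg gl_coef.

HB.instance Definition _ := GRing.Algebra.on gl_alg.

Definition gl_gen (i j : 'I_n) : gl_alg := sk_gen gl_coef (i, j).

Lemma gl_gen_rel (i j k l : 'I_n) :
  gl_gen i j * gl_gen k l =
  (Q_theta theta i j k l) ^+ 2 *: (gl_gen k l * gl_gen i j).
Proof. exact: (sk_gen_rel gl_coef). Qed.

(* Lambda^{KJ} *)
Definition minor (d : nat) (K J : d.-tuple 'I_n) : gl_alg :=
  \sum_(s : 'S_d)
    ((-1) ^+ s *
     \prod_(a < d) \prod_(b < d | (a < b)%N)
        Q_theta theta (tnth K b) (tnth J (s b)) (tnth K a) (tnth J (s a))) *:
    \prod_(a < d) gl_gen (tnth K a) (tnth J (s a)).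

(* Lambda^J, with rows (1 ... d), i.e. 0, ..., d-1 in 'I_n. *)
Definition minor_top (d : nat) (led : (d <= n)%N) (J : d.-tuple 'I_n) :
    gl_alg :=
  minor [tuple widen_ord led a | a < d] J.

End GLTheta.

(* I^gamma: delete the gamma-th entry. *)
Definition del_entry (T : Type) (d : nat) (I : d.+1.-tuple T) (g : 'I_d.+1) :
    d.-tuple T :=
  [tuple tnth I (lift g a) | a < d].

(* x :: J, at length d rather than d.-1.+1. *)
Definition concat_entry (T : Type) (d : nat) (d_gt0 : (0 < d)%N) (x : T)
    (J : d.-1.-tuple T) : d.-tuple T :=
  tcast (prednK d_gt0) [tuple of x :: J].

(* Main.v *)
Require Import Defs.
From mathcomp Require Import all_boot all_order all_algebra all_fingroup.
From mathcomp Require Import reals complex.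
From mathcomp Require Import exp trigo.
From mathcomp Require Import ring zify.

Set Implicit Arguments.
Unset Strict Implicit.
Unset Printing Implicit Defensive.

Import GRing.Theory Num.Theory.

Local Open Scope ring_scope.

(** Up to scalars, the algebra of GL_theta(n) is a commutative polynomial ring.
    Write a generator as a pair x = (row, column), and Q x y for the number such
    that g_x g_y = Q(x, y)^2 g_y g_x.  Since Q(x, y) Q(y, x) = 1, the product
    of a word of generators, multiplied by Q(y, x) for each x standing before
    y, does not depend on the order of the word (perm_symprod).  The scalars in
    the definition of the minor are exactly these, so a minor is a signed sum
    of symmetrized words (minor_symprod), just as a determinant is a signed
    sum of monomials.

    Symmetrized words multiply by concatenation, up to the product of Q(x, y)
    over x in the left word and y in the right one (symprodM).  For two minors
    with the same rows the row part of this factor is the product of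
    q_(k_a k_b) over all a and b, which is 1 because q is skew; the
    column part is the product of q over all pairs of columns, the same for
    all terms of both minors (minorM).  In the term of index gamma of the
    Plücker sum, the column factors q_(i i_gamma), with i in I^gamma, cancel
    the first prefactor, while the factors q_(i j) together with the second
    prefactor give the product over all i in I and j in J, which does not
    involve gamma.  Hence the sum is a scalar times the classical Plücker sum,
    written with symmetrized words.

    The classical identity is proved by cancellation (plucker_symmetric).  In
    each word, the d + 1 entries of I fill d + 1 slots: the d slots of the
    first minor and the slot of the second one that receives i_gamma.  So the
    choice of gamma and of the permutation in the first minor is the choice of
    one permutation p of d + 1 points.  If the second minor puts i_gamma in row
    a, exchanging the contents of this slot and of the slot in row a of the
    first minor only reorders the word, but changes the sign of p. *)

(** * Symmetrized products of skew-commuting generators *)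

Section SymmetrizedProduct.
Variables (K : comNzRingType) (A : algType K) (X : eqType).
Variables (g : X -> A) (c : X -> X -> K).

Fixpoint symprod (s : seq X) : A :=
  if s is x :: s' then (\prod_(y <- s') c y x) *: (g x * symprod s') else 1.

(** The left-hand side is the shape of a term of the noncommutative minor. *)
Lemma symprod_ord (d : nat) (f : 'I_d -> X) :
  (\prod_(a < d) \prod_(b < d | (a < b)%N) c (f b) (f a)) *:
    \prod_(a < d) g (f a) = symprod [seq f a | a <- enum 'I_d].
Proof.
elim: d f => [|d IHd] f.
  by rewrite !big_ord0 scale1r (size0nil (size_enum_ord 0)).
rewrite enum_ordSl /= -map_comp -IHd big_map big_enum /=.
rewrite -scalerAr scalerA !big_ord_recl /=; congr (_ *: _); congr (_ * _).
  by rewrite big_mkcond big_ord_recl /= mul1r.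
apply: eq_bigr => a _.
by rewrite big_mkcond big_ord_recl /= mul1r [RHS]big_mkcond.
Qed.

Hypothesis c_skew : forall x y, c x y * c y x = 1.
Hypothesis g_comm : forall x y, g x * g y = (c x y) ^+ 2 *: (g y * g x).

(** The exponent 2 in the commutation relation is what makes this work: moving
    x past y costs c(x, y)^2, which turns the weight c(y, x) into c(x, y). *)
Lemma symprod_swap x y s : symprod [:: x, y & s] = symprod [:: y, x & s].
Proof.
rewrite /= !big_cons -!scalerAr !scalerA !mulrA g_comm -scalerAl scalerA.
congr (_ *: _).
set P := \prod_(z <- s) c z x; set P' := \prod_(z <- s) c z y.
transitivity (c x y * c y x * (c x y * P' * P)); first by ring.
by rewrite c_skew mul1r.
Qed.

Lemma symprod_mid x s1 s2 : symprod (s1 ++ x :: s2) = symprod (x :: s1 ++ s2).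
Proof.
elim: s1 => [//|y s1 IH].
rewrite cat_cons [RHS]symprod_swap [LHS]/= IH [RHS]/=.
by congr (_ *: _); rewrite !(big_cat, big_cons) /= mulrCA.
Qed.

Lemma perm_symprod s t : perm_eq s t -> symprod s = symprod t.
Proof.
elim: s t => [|x s IHs] t est.
  by case: t est => // y t /perm_size.
have xt: x \in t by rewrite -(perm_mem est) mem_head.
case/splitPr: xt est => t1 t2.
rewrite symprod_mid perm_sym -cat1s perm_catCA perm_sym /= perm_cons => est.
by rewrite (IHs _ est) (perm_big _ est).
Qed.

(** Concatenation brings in the weights c(y, x) for x in s and y in t; the
    scalar on the right undoes them. *)
Lemma symprodM s t :
  symprod s * symprod t =
  (\prod_(x <- s) \prod_(y <- t) c x y) *: symprod (s ++ t).
Proof.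
elim: s => [|x s IHs] /=; first by rewrite mul1r big_nil scale1r.
rewrite -scalerAl -mulrA IHs -scalerAr !scalerA; congr (_ *: _).
rewrite big_cons big_cat /= mulrACA [X in _ = _ * X]mulrC mulrACA.
have -> : (\prod_(y <- t) c x y) * (\prod_(y <- t) c y x) = 1.
  by rewrite -big_split big1 //= => y _; rewrite c_skew.
by rewrite mul1r mulrC.
Qed.

End SymmetrizedProduct.

(** The factors at (x, y) and (y, x) cancel.  The condition on the diagonal
    cannot be dropped: skewness alone leaves room for c x x = -1. *)
Lemma skew_prod_eq1 (K : comNzRingType) (T : Type) (c : T -> T -> K)
    (c_skew : forall x y, c x y * c y x = 1) (c_diag : forall x, c x x = 1)
    (s : seq T) :
  \prod_(x <- s) \prod_(y <- s) c x y = 1.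
Proof.
elim: s => [|x s IHs]; first by rewrite big_nil.
have -> : \prod_(z <- x :: s) \prod_(y <- x :: s) c z y =
    c x x * \prod_(y <- s) c x y *
      (\prod_(z <- s) c z x * \prod_(z <- s) \prod_(y <- s) c z y).
  rewrite big_cons big_cons; congr (_ * _).
  by rewrite -big_split; apply: eq_bigr => z _; rewrite big_cons.
by rewrite IHs mulr1 c_diag mul1r -big_split big1 //= => y _; rewrite c_skew.
Qed.

(** * The classical Plücker identity for permutation-invariant functions *)

(** Left multiplication by the transposition matches even permutations with
    odd ones. *)
Lemma sum_perm_alternating_eq0 (K : nzRingType) (V : lmodType K) (T : finType)
    (F : {perm T} -> V) (i j : T) :
  i != j -> (forall s, F (tperm i j * s)%g = F s) ->
  \sum_(s : {perm T}) (-1) ^+ s *: F s = 0.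
Proof.
move=> neq_ij Ft; pose t := tperm i j.
have oddMt s : (t * s)%g = ~~ s :> bool by rewrite odd_permM odd_tperm neq_ij.
rewrite (bigID (@odd_perm _)) /=.
apply: canLR (subrK _) _; rewrite add0r -sumrN.
rewrite (reindex_inj (mulgI t)); apply: eq_big => //= s.
by rewrite oddMt => /negPf->; rewrite Ft scaleN1r scale1r.
Qed.

(** This merges the deleted index g and a permutation of the remaining ones
    into one permutation that sends 0 to g. *)
Lemma sum_lift_perm (V : nmodType) (d : nat) (F : 'S_d.+1 -> V) :
  \sum_(g < d.+1) \sum_(s : 'S_d) F (lift_perm ord0 g s) =
  \sum_(p : 'S_d.+1) F p.
Proof.
rewrite pair_bigA /= [RHS](reindex (fun p => lift_perm ord0 p.1 p.2)) //=.
apply: onW_bij; apply: inj_card_bij.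
  move=> [g s] [h t] /= eq_gh.
  have := congr1 (fun p : 'S_d.+1 => p ord0) eq_gh; rewrite !lift_perm_id => ghE.
  rewrite ghE in eq_gh *; congr (_, _); apply/permP => k.
  by apply: (@lift_inj _ h); rewrite -!(lift_perm_lift ord0) eq_gh.
by rewrite card_prod !card_Sn card_ord factS.
Qed.

(** Two letters trade places between the two halves of the word, so only its
    order changes. *)
Lemma perm_swap_at (X T : eqType) (f f' h h' : T -> X) (s : seq T) (a : T) :
  a \in s -> uniq s -> f' a = h a -> h' a = f a ->
  (forall b, b != a -> f' b = f b) -> (forall b, b != a -> h' b = h b) ->
  perm_eq ([seq f' b | b <- s] ++ [seq h' b | b <- s])
          ([seq f b | b <- s] ++ [seq h b | b <- s]).
Proof.
move=> /perm_to_rem ps us fa ha ff hh.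
have ext (k k' : T -> X) : (forall b, b != a -> k' b = k b) ->
    [seq k' b | b <- rem a s] = [seq k b | b <- rem a s].
  by move=> kk; apply/eq_in_map => b; rewrite (mem_rem_uniq _ us) => /andP[/kk].
have e2 (k k' : T -> X) : perm_eq ([seq k b | b <- s] ++ [seq k' b | b <- s])
    ((k a :: [seq k b | b <- rem a s]) ++ (k' a :: [seq k' b | b <- rem a s])).
  by apply: perm_cat; exact: (perm_map _ ps).
apply/seq.permP => p; rewrite (seq.permP (e2 f' h')) (seq.permP (e2 f h)).
by rewrite fa ha (ext _ _ ff) (ext _ _ hh) !count_cat /=; lia.
Qed.

(** The letter e a j stands for the generator in row a and column j, and F for
    the evaluation of commutative monomials.  For a fixed permutation t of the
    second minor, a = t^-1 0 is the row where the entry of I sits; exchanging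
    it with the entry in row a of the first minor is the transposition of 0
    and lift 0 a. *)
Lemma plucker_symmetric (K : comNzRingType) (V : lmodType K) (X : eqType)
    (C : Type) (F : seq X -> V) (m : nat)
    (e : 'I_m.+1 -> C -> X) (I : m.+2.-tuple C) (J : m.-tuple C)
    (F_perm : forall s t, perm_eq s t -> F s = F t) :
  \sum_(g < m.+2) (-1) ^+ g *:
    \sum_(s : 'S_m.+1) \sum_(t : 'S_m.+1) ((-1) ^+ s * (-1) ^+ t) *:
      F ([seq e a (tnth (del_entry I g) (s a)) | a <- enum 'I_m.+1] ++
         [seq e a (tnth [tuple of tnth I g :: J] (t a)) | a <- enum 'I_m.+1])
  = 0.
Proof.
(* Slot 0 of p is the entry of I that goes into the second minor. *)
pose w (t : 'S_m.+1) (p : 'S_m.+2) :=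
  [seq e a (tnth I (p (lift ord0 a))) | a <- enum 'I_m.+1] ++
  [seq e a (tnth [tuple of tnth I (p ord0) :: J] (t a)) | a <- enum 'I_m.+1].
transitivity (\sum_(t : 'S_m.+1) (-1) ^+ t *:
    \sum_(p : 'S_m.+2) (-1) ^+ p *: F (w t p)).
  under [RHS]eq_bigr do rewrite -sum_lift_perm scaler_sumr.
  rewrite exchange_big; apply: eq_bigr => g _ /=; rewrite scaler_sumr.
  under [RHS]eq_bigr do rewrite scaler_sumr.
  rewrite exchange_big; apply: eq_bigr => s _ /=; rewrite scaler_sumr.
  apply: eq_bigr => t _.
  rewrite /w odd_lift_perm lift_perm_id /= !scalerA; congr (_ *: F (_ ++ _)).
    by rewrite signr_addb signr_odd mulrA [RHS]mulrC.
  by apply: eq_map => a; rewrite lift_perm_lift tnth_mktuple.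
rewrite big1 // => t _; pose a := (t^-1 ord0)%g.
rewrite (sum_perm_alternating_eq0 (neq_lift ord0 a)) ?scaler0 // => p.
apply: F_perm; apply: (perm_swap_at (a := a)); rewrite ?mem_enum ?enum_uniq //.
- by rewrite permM tpermR permKV !tnth0.
- by rewrite permKV !tnth0 permM tpermL.
- by move=> b neq_ba; rewrite permM tpermD ?neq_lift // (inj_eq lift_inj) eq_sym.
move=> b neq_ba; congr (e b _).
case: (unliftP ord0 (t b)) => [k ->|tb0]; first by rewrite !tnthS.
by case/eqP: neq_ba; rewrite /a -tb0 permK.
Qed.

(** * Products of noncommutative minors *)

Lemma cexp0 (R : realType) : cexp (0 : R[i]) = 1.
Proof. by rewrite /cexp /= expR0 cos0 sin0 mulr1 mulr0. Qed.

Lemma cexpD (R : realType) (z w : R[i]) : cexp (z + w) = cexp z * cexp w.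
Proof.
case: z w => [a b] [c d]; rewrite /cexp /= expRD sinD cosD.
by apply/eqP; rewrite eq_complex /=; apply/andP; split; apply/eqP; ring.
Qed.

Section MinorProducts.
Variables (R : realType) (n : nat) (theta : 'M[R[i]]_n).
Hypothesis theta_skew : theta^T = - theta.

Lemma q_theta_skew (i j : 'I_n) : q_theta theta i j * q_theta theta j i = 1.
Proof.
have tij : theta j i = - theta i j.
  by have /matrixP/(_ i j) := theta_skew; rewrite !mxE.
by rewrite /q_theta -cexpD tij mulrN subrr cexp0.
Qed.

Lemma q_theta_diag (i : 'I_n) : q_theta theta i i = 1.
Proof.
have /matrixP/(_ i i) := theta_skew; rewrite !mxE => /eqP.
rewrite -addr_eq0 -mulr2n mulrn_eq0 /= => /eqP tii.
by rewrite /q_theta tii mulr0 cexp0.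
Qed.

Definition Q_pair (x y : 'I_n * 'I_n) : R[i] := Q_theta theta x.1 x.2 y.1 y.2.

Lemma Q_pair_skew x y : Q_pair x y * Q_pair y x = 1.
Proof. by rewrite /Q_pair /Q_theta mulrACA !q_theta_skew mulr1. Qed.

Definition gl_symprod (s : seq ('I_n * 'I_n)) : gl_alg theta :=
  symprod (fun x => gl_gen theta x.1 x.2) Q_pair s.

Lemma perm_gl_symprod s t : perm_eq s t -> gl_symprod s = gl_symprod t.
Proof.
apply: perm_symprod; first exact: Q_pair_skew.
by move=> x y; exact: gl_gen_rel.
Qed.

Lemma minor_symprod (d : nat) (K J : d.-tuple 'I_n) :
  minor theta K J =
  \sum_(s : 'S_d) (-1) ^+ s *:
    gl_symprod [seq (tnth K a, tnth J (s a)) | a <- enum 'I_d].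
Proof.
apply: eq_bigr => s _; rewrite -scalerA; congr (_ *: _).
exact: (symprod_ord (fun x => gl_gen theta x.1 x.2) Q_pair
          (fun a => (tnth K a, tnth J (s a)))).
Qed.

(** Permuting the columns of a minor only permutes the factors of its scalar;
    this is why one scalar serves all pairs (s, t). *)
Lemma minorM (d : nat) (K A B : d.-tuple 'I_n) :
  minor theta K A * minor theta K B =
  (\prod_(a < d) \prod_(b < d) q_theta theta (tnth A a) (tnth B b)) *:
  \sum_(s : 'S_d) \sum_(t : 'S_d) ((-1) ^+ s * (-1) ^+ t) *:
    gl_symprod ([seq (tnth K a, tnth A (s a)) | a <- enum 'I_d] ++
                [seq (tnth K a, tnth B (t a)) | a <- enum 'I_d]).
Proof.
rewrite !minor_symprod mulr_suml scaler_sumr; apply: eq_bigr => s _.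
rewrite mulr_sumr scaler_sumr; apply: eq_bigr => t _.
have rows : \prod_(a < d) \prod_(b < d) q_theta theta (tnth K a) (tnth K b) = 1.
  rewrite -[RHS](skew_prod_eq1 q_theta_skew q_theta_diag K) big_tuple.
  by apply: eq_bigr => a _; rewrite big_tuple.
have Q_words : \prod_(x <- [seq (tnth K a, tnth A (s a)) | a <- enum 'I_d])
      \prod_(y <- [seq (tnth K a, tnth B (t a)) | a <- enum 'I_d]) Q_pair x y =
    \prod_(a < d) \prod_(b < d) q_theta theta (tnth A a) (tnth B b).
  rewrite big_map big_enum /=.
  rewrite (eq_bigr (fun a => \prod_(b < d) q_theta theta (tnth K b) (tnth K a) *
      \prod_(b < d) q_theta theta (tnth A (s a)) (tnth B b))); last first.
    move=> a _; rewrite big_map big_enum /= big_split /=; congr (_ * _).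
    by rewrite [RHS](reindex_perm t).
  rewrite big_split exchange_big rows /= mul1r.
  by rewrite [RHS](reindex_perm s).
rewrite -scalerAl -scalerAr scalerA [gl_symprod _ * _](symprodM _ Q_pair_skew).
by rewrite Q_words !scalerA; congr (_ *: _); rewrite mulrC.
Qed.

(** The common rows K are arbitrary, since their contribution to the scalar of
    a product of two minors is always 1. *)
Lemma minor_plucker (m : nat) (K : m.+1.-tuple 'I_n) (I : m.+2.-tuple 'I_n)
    (J : m.-tuple 'I_n) :
  \sum_(g < m.+2)
    ((-1) ^+ g *
     (\prod_(a < m.+1) q_theta theta (tnth I g) (tnth (del_entry I g) a)) *
     (\prod_(b < m) q_theta theta (tnth I g) (tnth J b))) *:
    (minor theta K (del_entry I g) *
     minor theta K [tuple of tnth I g :: J]) = 0.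
Proof.
(* The scalar common to all terms: it pairs every entry of I with every entry
   of J. *)
pose c := \prod_(k < m.+2) \prod_(b < m) q_theta theta (tnth I k) (tnth J b).
have /(congr1 ( *:%R c)) := plucker_symmetric
  (fun a j => (tnth K a, j)) I J perm_gl_symprod.
rewrite scaler0 => symmetric0; rewrite -[RHS]symmetric0 scaler_sumr.
apply: eq_bigr => g _.
have split_first (a : 'I_m.+1) :
    \prod_(b < m.+1) q_theta theta (tnth (del_entry I g) a)
       (tnth [tuple of tnth I g :: J] b) =
    q_theta theta (tnth (del_entry I g) a) (tnth I g) *
    \prod_(b < m) q_theta theta (tnth I (lift g a)) (tnth J b).
  rewrite big_ord_recl tnth0 tnth_mktuple; congr (_ * _).
  by apply: eq_bigr => b _; rewrite tnthS.
have coefE : (-1) ^+ g *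
     (\prod_(a < m.+1) q_theta theta (tnth I g) (tnth (del_entry I g) a)) *
     (\prod_(b < m) q_theta theta (tnth I g) (tnth J b)) *
     (\prod_(a < m.+1) \prod_(b < m.+1) q_theta theta
        (tnth (del_entry I g) a) (tnth [tuple of tnth I g :: J] b)) =
   c * (-1) ^+ g.
  rewrite (eq_bigr _ (fun a _ => split_first a)) big_split /=.
  rewrite /c (bigD1_ord g) //=.
  set u := \prod_(a < _) _; set v := \prod_(b < _) _.
  set u' := \prod_(a < _) _; set w := \prod_(a < _) _.
  have uu : u * u' = 1.
    by rewrite -big_split big1 //= => a _; exact: q_theta_skew.
  transitivity ((u * u') * (v * w * (-1) ^+ g)); first by ring.
  by rewrite uu mul1r.
by rewrite minorM [LHS]scalerA [RHS]scalerA coefE.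
Qed.

End MinorProducts.

Theorem proposition5p8 (R : realType) (n : nat) (n_gt0 : (1 <= n)%N)
    (theta : 'M[R[i]]_n) (theta_skew : theta^T = - theta)
    (d : nat) (d_gt0 : (1 <= d)%N) (d_le_n : (d <= n)%N)
    (I : d.+1.-tuple 'I_n) (J : d.-1.-tuple 'I_n) :
  \sum_(g < d.+1)
    ((-1) ^+ g.+2 *
     (\prod_(a < d) q_theta theta (tnth I g) (tnth (del_entry I g) a)) *
     (\prod_(b < d.-1) q_theta theta (tnth I g) (tnth J b))) *:
    (minor_top theta d_le_n (del_entry I g) *
     minor_top theta d_le_n (concat_entry d_gt0 (tnth I g) J)) = 0.
Proof.
case: d d_gt0 d_le_n I J => [//|m] m_gt0 m_le_n I J.
rewrite -[RHS](minor_plucker theta_skew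
  [tuple widen_ord m_le_n a | a < m.+1] I J).
by apply: eq_bigr => g _; rewrite /concat_entry tcast_id !exprS !mulN1r opprK.
Qed.
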